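(* Let $I$ be a finite nonempty set, $r\ge1$, $d\ge0$ integers, $i_0\in I$, and let $\mathcal C=(\mathbb P^1,(p_\lambda)_{\lambda\in L_0},f)$ be a labeled parametrized $I$-marked curve of degree $d$ in $\mathbb P^r$ in standard form, with corresponding tropical curve $\mathfrak C_{\mathcal C}=(\mathfrak C,(e_\lambda),\mathfrak f)$. Then $$\mathfrak f(\mathfrak C^\circ)\cap\Gamma_\nu(\mathfrak T^r)=\operatorname{trop}\bigl(f(\mathbb P^1)\cap\mathbb T^r\bigr),$$ and for every $i\in I$ we have $\mathfrak{ev}_i(\mathfrak C_{\mathcal C})=\operatorname{trop}(\operatorname{ev}_i(\mathcal C))$.
   Context: Ground field: $(K,\nu)$ is an algebraically closed valued field of characteristic $0$ (valuation possibly trivial), $\nu(0)=\infty$, with value group $\Gamma_\nu=\nu(K^* )\subseteq\mathbb R$. Points of varieties are $K$-points. $\mathbb T^r\subset\mathbb P^r$ is the torus of points with all coordinates nonzero; $\mathfrak T^r=\mathbb R^{r+1}/\mathbb R(1,\dots,1)$ with lattice $N$ the image of $\mathbb Z^{r+1}$; $s_i$ is the image of the $i$-th standard basis vector; $\Gamma_\nu(\mathfrak T^r)=\Gamma_\nu\otimes N$ is the image of $\Gamma_\nu^{r+1}$; $\operatorname{trop}:\mathbb T^r\to\mathfrak T^r$ sends $(x_0:\dots:x_r)$ to the class of $(\nu(x_0),\dots,\nu(x_r))$. Let $J=\{0,\dots,r\}\times\{1,\dots,d\}$ and $L_0=I\cup J$ (disjoint union); it is assumed that $|L_0|\ge3$.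 Algebraic curves: a labeled parametrized $I$-marked rational curve of degree $d$ in $\mathbb P^r$ is $(C,(p_\lambda)_{\lambda\in L_0},f)$ with $C\cong\mathbb P^1$, distinct points $p_\lambda\in C$, and $f:C\to\mathbb P^r$ a morphism of degree $d$ ($f_*[C]=d$) such that $f^{-1}(\{x_i=0\})=\{p_{ij}\mid1\le j\le d\}$ for each $i=0,\dots,r$. $\operatorname{ev}_i(\mathcal C)=f(p_i)\in\mathbb T^r$ for $i\in I$. Tropical curves: an abstract rational tropical curve is a finite metric tree $\mathfrak C=(V,E,\ell)$, $\ell:E\to\mathbb R_{>0}\cup\{\infty\}$, without $2$-valent vertices and not consisting of exactly two vertices, such that the edges of infinite length are exactly those incident to a $1$-valent vertex (''legs''; the $1$-valent vertices are ''feet'', other vertices ''inner''); $\mathfrak C^\circ$ is $\mathfrak C$ without the feet. A labeled parametrized $I$-marked tropical curve of degree $d$ in $\mathfrak T^r$ is $(\mathfrak C,(e_\lambda)_{\lambda\in L_0},\mathfrak f)$, where $\lambda\mapsto e_\lambda$ is a bijection from $L_0$ to the legs and $\mathfrak f:\mathfrak C^\circ\to\mathfrak T^r$ is continuous and affine linear on edges, with integral direction vectors, balanced at each inner vertex, with direction $s_i$ on $e_{(i,j)}$ for $(i,j)\in J$ and direction $0$ on $e_i$ for $i\in I$. $\mathfrak{ev}_i$ ($i\in I$) sends the curve to the point $\mathfrak f(e_i)$. Standard form and corresponding tropical curve: $\mathcal C$ is in standard form if $C=\mathbb P^1$ and $p_{i_0}=(0:1)$; then $p_\lambda=(1:a_\lambda)$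 with unique $a_\lambda\in K$ for $\lambda\in L:=L_0\setminus\{i_0\}$. Write $f(p_{i_0})=(c_0:\dots:c_r)$. For nonempty $A\subseteq L$ let $\nu(A)=\min\{\nu(a_\mu-a_\lambda)\mid\lambda,\mu\in A\}\in\mathbb R\cup\{\infty\}$. Let $V$ be the set of nonempty $A\subseteq L$ which are maximal for the partial order $A\preceq B:\Leftrightarrow A\subseteq B$ and $\nu(A)=\nu(B)$. Order $V$ by inclusion and connect two elements by an edge iff one covers the other; this is a tree with vertex $L$. Give the edge $\{v\subset w\}$ length $\nu(v)-\nu(w)$, and attach an additional foot $\{i_0\}$ to $L$ along a leg; this is an abstract tropical curve $\mathfrak C$ whose leg $e_\lambda$ is the one with foot $\{\lambda\}$, $\lambda\in L_0$. For $A\subseteq L_0$ let $s_A=\sum_{i=0}^r|A\cap(\{i\}\times\{1,\dots,d\})|\,s_i$. For an inner vertex $v$ with path $L=v_0,v_1,\dots,v_k=v$ from $L$, let $q_v=\sum_{i=0}^r\nu(c_i)s_i+\sum_{i=1}^k\ell(\{v_i,v_{i-1}\})s_{v_i}$. Let $\mathfrak f:\mathfrak C^\circ\to\mathfrak T^r$ send each inner vertex $v$ to $q_v$, interpolate linearly on bounded edges, and have direction $s_v$ on the leg with foot $v$. Then $\mathfrak C_{\mathcal C}=(\mathfrak C,(e_\lambda),\mathfrak f)$ is a labeled parametrized $I$-marked tropical curve of degree $d$ in $\mathfrak T^r$, called the corresponding tropical curve to $\mathcal C$. *)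

(* Defs.v *)
From HB Require Import structures.
From mathcomp Require Import all_boot all_order all_algebra.
From mathcomp Require Import boolp classical_sets constructive_ereal reals.

Set Implicit Arguments.
Unset Strict Implicit.
Unset Printing Implicit Defensive.

Import Order.TTheory GRing.Theory Num.Theory.

Local Open Scope ring_scope.
Local Open Scope quotient_scope.

Record valuation (K : fieldType) (R : realType) := Valuation {
  val_fun :> K -> \bar R;
  val_neqNy : forall x, val_fun x <> -oo%E;
  val_eqy : forall x, val_fun x = +oo%E <-> x = 0;
  valM : forall x y, val_fun (x * y) = (val_fun x + val_fun y)%E;
  valD : forall x y, (mine (val_fun x) (val_fun y) <= val_fun (x + y))%E }.

Definition value_group (K : fieldType) (R : realType) (nu : valuation K R) :
    set R :=
  [set fine (nu x) | x in [set x : K | x != 0]]%classic.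

Section ProjectiveSpace.
Variables (K : fieldType) (n : nat).

Definition nzvec := {x : 'rV[K]_n.+1 | x != 0}.

(* Equality of row spaces of nonzero row vectors, i.e. proportionality. *)
Definition proportional (x y : nzvec) : bool := (val x == val y)%MS.

Lemma proportional_refl : reflexive proportional.
Proof. by move=> x; rewrite /proportional !submx_refl. Qed.

Lemma proportional_sym : symmetric proportional.
Proof. by move=> x y; rewrite /proportional andbC. Qed.

Lemma proportional_trans : transitive proportional.
Proof.
move=> y x z /andP[xy yx] /andP[yz zy]; apply/andP.
by split; [apply: submx_trans yz | apply: submx_trans yx].
Qed.

Canonical proportional_equiv :=
  EquivRel proportional proportional_refl proportional_sym proportional_trans.

Definition PP := {eq_quot proportional}.
HB.instance Definition _ : EqQuotient nzvec proportional PP :=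
  EqQuotient.on PP.

Lemma const_mx1_neq0 : const_mx 1 != 0 :> 'rV[K]_n.+1.
Proof.
apply/eqP => /matrixP /(_ 0 0) /eqP.
by rewrite !mxE oner_eq0.
Qed.

(* The point (x_0 : ... : x_n); a junk value when x = 0. *)
Definition proj (x : 'rV[K]_n.+1) : PP :=
  \pi_PP (insubd (exist _ (const_mx 1) const_mx1_neq0 : nzvec) x).

Definition hcoord (P : PP) : 'rV[K]_n.+1 := val (repr P).

Lemma hcoord_neq0 P : hcoord P != 0.
Proof. exact: (svalP (repr P)). Qed.

Lemma hcoordK : cancel hcoord proj.
Proof. by move=> P; rewrite /proj /hcoord valKd reprK. Qed.

Lemma proj_eqP (x y : 'rV[K]_n.+1) : x != 0 -> y != 0 ->
  proj x = proj y <-> exists2 c : K, c != 0 & y = c *: x.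
Proof.
move=> x0 y0; apply: (iff_trans (rwP eqP)).
rewrite /proj eqquotE /proportional.
rewrite !insubdK //; split=> [/andP[_ /sub_rVP[c yE]]|[c c0 ->]].
  by exists c => //; apply: contra_neq y0 => c0; rewrite yE c0 scale0r.
apply/andP; split; last exact: scalemx_sub.
by rewrite -{1}[x]scale1r -(mulVf c0) -scalerA scalemx_sub.
Qed.

Lemma hcoord_proj x : x != 0 ->
  exists2 c : K, c != 0 & hcoord (proj x) = c *: x.
Proof.
by move=> x0; apply/proj_eqP; rewrite ?hcoord_neq0 ?hcoordK.
Qed.

Definition hyperplane (i : 'I_n.+1) : set PP :=
  [set P | hcoord P 0 i = 0]%classic.

Definition torus : set PP :=
  [set P | forall i, hcoord P 0 i != 0]%classic.

Lemma hyperplaneP i x : x != 0 -> hyperplane i (proj x) <-> x 0 i = 0.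
Proof.
move=> x0; rewrite /hyperplane /=; have [c c0 ->] := hcoord_proj x0.
rewrite mxE; split=> [/eqP|->]; last by rewrite mulr0.
by rewrite mulf_eq0 (negPf c0) => /eqP.
Qed.

Lemma torusP x : x != 0 -> torus (proj x) <-> forall i, x 0 i != 0.
Proof.
move=> x0; rewrite /torus /=; have [c c0 ->] := hcoord_proj x0.
by split=> H i; move: (H i); rewrite mxE mulf_eq0 (negPf c0).
Qed.

End ProjectiveSpace.

Arguments hyperplane {K n} i.
Arguments torus K n : clear implicits.

Section TropicalTorus.
Variables (R : realType) (r : nat).

(* The line spanned by (1, ..., 1). *)
Definition diagonal : {pred 'rV[R]_r.+1} :=
  fun u => (u <= (const_mx 1 : 'rV[R]_r.+1))%MS.

Lemma diagonal_zmod_closed : zmod_closed diagonal.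
Proof.
split=> [|u v du dv]; rewrite unfold_in /diagonal ?sub0mx //.
by rewrite addmx_sub // eqmx_opp.
Qed.

HB.instance Definition _ :=
  GRing.isZmodClosed.Build 'rV[R]_r.+1 diagonal diagonal_zmod_closed.

Definition TT := Quotient.quot diagonal.
HB.instance Definition _ := GRing.Zmodule.on TT.
HB.instance Definition _ := ZmodQuotient.on TT.

Definition TT_scale (c : R) (P : TT) : TT := \pi_TT (c *: repr P).

Lemma TT_scale_pi c u : TT_scale c (\pi_TT u) = \pi_TT (c *: u).
Proof.
apply/eqP; rewrite /TT_scale -Quotient.idealrBE -scalerBr unfold_in /diagonal.
by apply: scalemx_sub; have := Quotient.idealrBE diagonal (repr (\pi_TT u)) u;
  rewrite reprK eqxx unfold_in.
Qed.

Lemma TT_scaleA a b P : TT_scale a (TT_scale b P) = TT_scale (a * b) P.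
Proof.
by elim/quotW: P => u; rewrite (TT_scale_pi b) !TT_scale_pi scalerA.
Qed.

Lemma TT_scale1 : left_id 1 TT_scale.
Proof. by elim/quotW=> u; rewrite TT_scale_pi scale1r. Qed.

Lemma TT_scaleDr : right_distributive TT_scale +%R.
Proof.
move=> a; elim/quotW=> u; elim/quotW=> v.
by rewrite !TT_scale_pi -!raddfD /= TT_scale_pi scalerDr.
Qed.

Lemma TT_scaleDl P : {morph TT_scale^~ P : a b / a + b}.
Proof.
by elim/quotW: P => u a b; rewrite !TT_scale_pi scalerDl raddfD.
Qed.

HB.instance Definition _ :=
  GRing.Zmodule_isLmodule.Build R TT TT_scaleA TT_scale1 TT_scaleDr TT_scaleDl.

Lemma pi_TT_scalable : scalable (\pi_TT : 'rV[R]_r.+1 -> TT).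
Proof. by move=> c u; rewrite -TT_scale_pi. Qed.

HB.instance Definition _ :=
  GRing.isScalable.Build R 'rV[R]_r.+1 TT *:%R (\pi_TT) pi_TT_scalable.

Definition svec (i : 'I_r.+1) : TT := \pi_TT (delta_mx 0 i).

Variables (K : fieldType) (nu : valuation K R).

Definition Gamma_points : set TT :=
  [set \pi_TT u | u in
    [set u : 'rV[R]_r.+1 | forall i, value_group nu (u 0 i)]]%classic.

(* Only meaningful on the torus, where all coordinates have finite valuation. *)
Definition trop (P : PP K r) : TT :=
  \pi_TT (\row_i fine (nu (hcoord P 0 i))).

Lemma trop_proj (x : 'rV[K]_r.+1) : (forall i, x 0 i != 0) ->
  trop (proj x) = \pi_TT (\row_i fine (nu (x 0 i))).
Proof.
move=> xn0; have x0 : x != 0.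
  by apply/eqP => xE; have := xn0 0; rewrite xE mxE eqxx.
have [c c0 hE] := hcoord_proj x0; rewrite /trop hE.
have nufin (y : K) : y != 0 -> nu y \is a fin_num.
  move=> /eqP y0; rewrite fin_numE; apply/andP; split; apply/eqP.
    exact: val_neqNy.
  by move=> /val_eqy.
apply/eqP; rewrite -Quotient.idealrBE unfold_in /diagonal.
have -> : \row_i fine (nu ((c *: x) 0 i)) - \row_i fine (nu (x 0 i)) =
    fine (nu c) *: (const_mx 1 : 'rV[R]_r.+1).
  apply/rowP => i; rewrite !mxE valM fineD ?nufin //.
  by rewrite addrK mulr1.
exact: scalemx_sub.
Qed.

End TropicalTorus.

Arguments svec {R r} i.
Arguments Gamma_points {R} r {K} nu.

(* [mor_eval F x] evaluates at x = (x_0, x_1) the r+1 binary forms of degree d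
   whose coefficients are the rows of F:
   F_i = \sum_k F_ik x_0^(d-k) x_1^k. *)
Definition mor_eval (K : fieldType) (r d : nat) (F : 'M[K]_(r.+1, d.+1))
    (x : 'rV[K]_2) : 'rV[K]_r.+1 :=
  \row_i \sum_(k < d.+1) F i k * x 0 ord0 ^+ (d - k) * x 0 ord_max ^+ k.

(* The morphisms P^1 -> P^r of degree d are those given by r+1 binary forms of
   degree d without common zero. *)
Definition is_morphism_of_degree (K : fieldType) (r d : nat)
    (f : PP K 1 -> PP K r) : Prop :=
  exists F : 'M[K]_(r.+1, d.+1), forall x : 'rV[K]_2, x != 0 ->
    mor_eval F x != 0 /\ f (proj x) = proj (mor_eval F x).

(* The label set L_0, the disjoint union of I and J. *)
Definition label (I : finType) (r d : nat) : finType :=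
  (I + 'I_r.+1 * 'I_d)%type.

(* The source curve is taken to be P^1 itself, as standard form requires. *)
Record marked_curve (K : closedFieldType) (I : finType) (r d : nat) :=
  MarkedCurve {
    mark : label I r d -> PP K 1;
    param : PP K 1 -> PP K r;
    mark_inj : injective mark;
    param_morphism : is_morphism_of_degree d param;
    param_hyperplane : forall i : 'I_r.+1,
      (param @^-1` hyperplane i = [set mark (inr (i, j)) | j in setT])%classic }.

Definition ev (K : closedFieldType) (I : finType) (r d : nat)
    (C : marked_curve K I r d) (i : I) : PP K r := param C (mark C (inl i)).

Definition standard_form (K : closedFieldType) (I : finType) (r d : nat)
    (C : marked_curve K I r d) (i0 : I) : Prop :=
  mark C (inl i0) = proj (delta_mx 0 ord_max).

(* The a with P = (1 : a), for P <> (0 : 1). *)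
Definition affine_coord (K : fieldType) (P : PP K 1) : K :=
  hcoord P 0 ord_max / hcoord P 0 ord0.

Lemma affine_coordP (K : fieldType) (P : PP K 1) (a : K) :
  P != proj (delta_mx 0 ord_max) ->
  P = proj (delta_mx 0 ord0 + a *: delta_mx 0 ord_max) <-> a = affine_coord P.
Proof.
have ord2P (i : 'I_2) : i = ord0 \/ i = ord_max.
  by case: i => [[|[|//]] ?]; [left | right]; apply: val_inj.
have yn0 (b : K) : delta_mx 0 ord0 + b *: delta_mx 0 ord_max != 0 :> 'rV[K]_2.
  apply/eqP => /rowP /(_ ord0) /eqP.
  by rewrite !mxE /= mulr0 addr0 oner_eq0.
have en0 : delta_mx 0 ord_max != 0 :> 'rV[K]_2.
  by apply/eqP => /rowP /(_ ord_max) /eqP; rewrite !mxE /= oner_eq0.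
move=> Poo; have h0 : hcoord P 0 ord0 != 0.
  apply: contra_neq Poo => h0; rewrite -[LHS]hcoordK.
  apply/proj_eqP; rewrite ?hcoord_neq0 //.
  have hm : hcoord P 0 ord_max != 0.
    apply: contra_neq (hcoord_neq0 P) => hm; apply/rowP => i.
    by rewrite mxE; case: (ord2P i) => ->.
  exists (hcoord P 0 ord_max)^-1; first by rewrite invr_eq0.
  by apply/rowP => i; case: (ord2P i) => ->; rewrite !mxE /= ?h0 ?mulr0 ?mulVf.
split=> [PE|->].
  have [c c0 hE] := hcoord_proj (yn0 a).
  rewrite /affine_coord PE hE !mxE /= !mulr0 !mulr1 addr0 add0r mulr1.
  by rewrite mulrAC mulfV ?mul1r.
rewrite -[LHS]hcoordK; apply/proj_eqP; rewrite ?hcoord_neq0 //.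
exists (hcoord P 0 ord0)^-1; first by rewrite invr_eq0.
apply/rowP => i; case: (ord2P i) => ->; rewrite !mxE /=.
  by rewrite mulr0 addr0 mulVf.
by rewrite mulr1 add0r mulrC.
Qed.

Section CorrespondingTropicalCurve.
Variables (K : closedFieldType) (R : realType) (nu : valuation K R).
Variables (I : finType) (r d : nat) (C : marked_curve K I r d) (i0 : I).

Local Notation L0 := (label I r d).
Local Notation TT := (TT R r).
Implicit Types (A B u v w : {set L0}) (l m : L0).

(* L = L_0 \ {i_0}, both as a set of labels and as a vertex of the tree. *)
Definition Ltop : {set L0} := [set~ inl i0].

Definition a_coord l : K := affine_coord (mark C l).

Definition nu_set A : \bar R :=
  \big[mine/+oo%E]_(l in A) \big[mine/+oo%E]_(m in A)
    nu (a_coord m - a_coord l).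

Definition tle A B : bool := (A \subset B) && (nu_set A == nu_set B).

(* The set V; the vertices of the tree are V and the extra foot {i_0}. *)
Definition is_cluster A : bool :=
  [&& A != finset.set0, A \subset Ltop &
    [forall B : {set L0}, (B \subset Ltop) && tle A B ==> (B == A)]].

Definition covers w v : bool :=
  [&& is_cluster w, is_cluster v, v \proper w &
    ~~ [exists u : {set L0}, [&& is_cluster u, v \proper u & u \proper w]]].

Definition foot l : {set L0} := [set l].

Definition is_tvertex v : bool := is_cluster v || (v == foot (inl i0)).

(* The edges, oriented away from the vertex L. *)
Definition tedge w v : bool :=
  covers w v || (w == Ltop) && (v == foot (inl i0)).

Definition tlength w v : \bar R :=
  if v == foot (inl i0) then +oo%E else (nu_set v - nu_set w)%E.

Definition is_foot v : bool :=
  is_tvertex v && (#|[set u | tedge u v || tedge v u]| == 1)%N.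

Definition is_inner v : bool := is_tvertex v && ~~ is_foot v.

Definition s_set A : TT :=
  \sum_(i < r.+1) #|[set j : 'I_d | inr (i, j) \in A]|%:R *: svec i.

(* The vertices v_1, ..., v_k following v_0 = L on the path from L to v. *)
Definition path_from_top v : seq {set L0} :=
  xget [::] [set p | path tedge Ltop p /\ last Ltop p = v]%classic.

Fixpoint path_displacement w (p : seq {set L0}) : TT :=
  if p is v :: p' then
    fine (tlength w v) *: s_set v + path_displacement v p'
  else 0.

Definition vertex_pos v : TT :=
  \sum_(i < r.+1) fine (nu (hcoord (ev C i0) 0 i)) *: svec i
  + path_displacement Ltop (path_from_top v).

(* [TEdge w v t] is the point of the edge {w, v}, oriented from w to v, at
   distance t from w. *)
Inductive tpoint := TVertex of {set L0} | TEdge of {set L0} & {set L0} & R.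

(* The curve without its feet: the inner vertices and the open edges. *)
Definition tcurve : set tpoint := fun x =>
  match x with
  | TVertex v => is_inner v
  | TEdge w v t => [/\ tedge w v, 0 < t & (t%:E < tlength w v)%E]
  end.

Definition tmap (x : tpoint) : TT :=
  match x with
  | TVertex v => vertex_pos v
  | TEdge w v t =>
      if is_foot v then vertex_pos w + t *: s_set v
      else vertex_pos w
           + (t / fine (tlength w v)) *: (vertex_pos v - vertex_pos w)
  end.

(* The leg e_l without its foot, including its inner end point. *)
Definition leg l : set tpoint := fun x =>
  tcurve x /\
  match x with
  | TVertex w => tedge w (foot l)
  | TEdge w v t => v = foot l
  end.

End CorrespondingTropicalCurve.

(* Main.v *)
(* For t real and a label l in L, let P(l, t) be the class of the vector with
   entries nu(c_i) + sum_j min(t, nu(a_ij - a_l)), where f(p_i0) = (c_0 : ... : c_r).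
   The vertices of the tree are the balls {m | nu(a_m - a_l) >= t}, and walking
   down from L to the foot l one finds that the tropical curve runs through P(l, t)
   at height t; so its image is the set of all P(l, t).  On the algebraic side
   f(1 : x) = (c_i prod_j (x - a_ij))_i, and if l maximizes t = nu(x - a_l), then
   nu(x - a_m) = min(t, nu(a_m - a_l)) for all m, so that f(1 : x) tropicalizes to
   P(l, t).  Conversely, for t in the value group, P(l, t) is the tropicalization
   of f(1 : a_l + y) for a sufficiently generic y of valuation t.  Finally, a point
   of an edge below w with coordinates in the value group either lies at a height
   in the value group, which is divisible, or the edge is contracted, and then the
   point is the image of w. *)
Require Import Defs.
From mathcomp Require Import all_boot all_order all_algebra.
From mathcomp Require Import boolp classical_sets constructive_ereal reals.
From mathcomp Require Import ring.

Set Implicit Arguments.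
Unset Strict Implicit.
Unset Printing Implicit Defensive.

Import Order.TTheory GRing.Theory Num.Theory.

Local Open Scope ring_scope.
Local Open Scope classical_set_scope.

(** * Valuations *)

Section ValuationTheory.
Variables (K : fieldType) (R : realType) (nu : valuation K R).

Lemma valuation0 : nu 0 = +oo%E.
Proof. by apply/val_eqy. Qed.

Lemma val_fin_num (x : K) : x != 0 -> nu x \is a fin_num.
Proof.
move=> /eqP x0; rewrite fin_numE; apply/andP; split; apply/eqP.
  exact: val_neqNy.
by move=> /val_eqy.
Qed.

Lemma fineK_val (x : K) : x != 0 -> (fine (nu x))%:E = nu x.
Proof. by move=> x0; rewrite fineK ?val_fin_num. Qed.

Lemma valuation1 : nu 1 = 0%E.
Proof.
have := Defs.valM nu 1 1; rewrite mulr1 -fineK_val ?oner_eq0 //.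
case=> h; congr EFin; apply: (addrI (fine (nu 1))).
by rewrite addr0 -h.
Qed.

Lemma valuationN (x : K) : nu (- x) = nu x.
Proof.
have n1 : -1 != 0 :> K by rewrite oppr_eq0 oner_eq0.
have : (nu (-1)%R + nu (-1)%R)%E = 0%E by rewrite -Defs.valM mulrNN mulr1
  valuation1.
rewrite -(fineK_val n1) => -[/eqP]; rewrite -mulr2n mulrn_eq0 /= => /eqP h.
by rewrite -mulN1r Defs.valM -(fineK_val n1) h add0e.
Qed.

Lemma val_subC (x y : K) : nu (x - y)%R = nu (y - x)%R.
Proof. by rewrite -valuationN opprB. Qed.

Lemma val_le_trans (t : \bar R) (x y z : K) :
  (t <= nu (x - y)%R)%E -> (t <= nu (y - z)%R)%E -> (t <= nu (x - z)%R)%E.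
Proof.
move=> xy yz; have -> : x - z = (x - y) + (y - z) by rewrite addrA subrK.
by apply: le_trans (Defs.valD _ _ _); rewrite le_min xy yz.
Qed.

(** One bound is the ultrametric inequality; if it were strict, x = y - (y - x) would have valuation
    larger than nu x. *)
Lemma valB_ltr (x y : K) : (nu x < nu y)%E -> nu (y - x)%R = nu x.
Proof.
move=> xy; apply/le_anti/andP; split; last first.
  by apply: le_trans (Defs.valD _ _ _); rewrite le_min valuationN lexx ltW.
rewrite leNgt; apply/negP => h.
have := Defs.valD nu y (- (y - x));
  rewrite valuationN opprB [y + (x - y)]addrC subrK.
by apply/negP; rewrite -ltNge lt_min xy h.
Qed.

Lemma val_prod (I : Type) (s : seq I) (F : I -> K) :
  nu (\prod_(i <- s) F i) = (\sum_(i <- s) nu (F i))%E.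
Proof.
elim: s => [|x s IH]; first by rewrite !big_nil valuation1.
by rewrite !big_cons Defs.valM IH.
Qed.

Lemma fine_valM (x y : K) : x != 0 -> y != 0 ->
  fine (nu (x * y)) = fine (nu x) + fine (nu y).
Proof. by move=> x0 y0; rewrite Defs.valM fineD ?val_fin_num. Qed.

Lemma fine_val_prod (I : Type) (s : seq I) (F : I -> K) :
  (forall i, F i != 0) ->
  fine (nu (\prod_(i <- s) F i)) = \sum_(i <- s) fine (nu (F i)).
Proof.
move=> F0; elim: s => [|x s IH]; first by rewrite !big_nil valuation1.
rewrite !big_cons fine_valM ?IH //.
by apply: (big_ind (fun y => y != 0)) => [|y z y0 z0|//];
  rewrite ?oner_eq0 ?mulf_neq0.
Qed.

Lemma value_groupP (t : R) :
  value_group nu t <-> exists2 x, x != 0 & nu x = t%:E.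
Proof.
split=> [[x /= x0 <-]|[x x0 xt]]; exists x => //; first by rewrite fineK_val.
by rewrite xt.
Qed.

Lemma value_groupV (x : K) : x != 0 -> value_group nu (fine (nu x)).
Proof. by move=> x0; exists x. Qed.

Lemma value_groupD (s t : R) :
  value_group nu s -> value_group nu t -> value_group nu (s + t)%R.
Proof.
move=> [x /= x0 <-] [y /= y0 <-]; exists (x * y); first by rewrite /= mulf_neq0.
by rewrite fine_valM.
Qed.

Lemma value_groupN (t : R) : value_group nu t -> value_group nu (- t).
Proof.
move=> [x /= x0 <-]; exists x^-1; first by rewrite /= invr_eq0.
apply/eqP; rewrite -subr_eq0 opprK -fine_valM ?invr_eq0 //.
by rewrite mulVf // valuation1.
Qed.

Lemma value_groupB (s t : R) :
  value_group nu s -> value_group nu t -> value_group nu (s - t)%R.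
Proof. by move=> hs ht; apply/value_groupD => //; apply: value_groupN. Qed.

End ValuationTheory.

(** * Valuations on an algebraically closed field *)

Section AlgebraicallyClosedValuation.
Variables (K : closedFieldType) (R : realType) (nu : valuation K R).

(** K has n-th roots: a root y of X^n - x, where nu x = n t, has n nu y = n t. *)
Lemma value_group_divisible (n : nat) (t : R) : (0 < n)%N ->
  value_group nu (t *+ n) -> value_group nu t.
Proof.
move=> n0 /value_groupP [x x0 xt].
have [y] := solve_monicpoly (fun i => if i == 0%N then x else 0) n0.
rewrite (bigD1 (Ordinal n0)) //= mulr1 big1 ?addr0 => [yx|i]; last first.
  by rewrite -val_eqE /= => /negPf ->; rewrite mul0r.
have y0 : y != 0.
  by apply: contra_neq x0 => y0; rewrite -yx y0 expr0n eqn0Ngt n0.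
apply/value_groupP; exists y => //.
have : fine (nu (y ^+ n)) = t *+ n by rewrite yx xt.
rewrite -[in y ^+ n](subn0 n) -prodr_const_nat fine_val_prod // sumr_const_nat
  subn0.
by move=> /eqP; rewrite eqrMn2r eqn0Ngt n0 /= => /eqP <-; rewrite fineK_val.
Qed.

(* A root y of X * \prod_b (X - b) = 1 is integral over the valuation ring, and
   so are all factors y - b; since their valuations add up to 0, they are all
   units. *)
Lemma exists_generic_unit (s : seq K) : all (fun b => (0 <= nu b)%E) s ->
  exists2 y, nu y = 0%E & all (fun b => nu (y - b)%R == 0%E) s.
Proof.
move=> /allP s_int.
set p : {poly K} := 'X * \prod_(b <- s) ('X - b%:P).
have sp : (1 < size p)%N.
  by rewrite /p mulrC size_mulX ?monic_neq0 ?monic_prod_XsubC //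
    size_prod_XsubC.
have /closed_rootP[y] : size (p - 1) != 1%N.
  by rewrite size_polyDl ?size_polyN ?size_poly1 ?neq_ltn ?sp ?orbT.
rewrite rootE !hornerE subr_eq0 horner_prod => /eqP yE.
have {yE} nuE : (nu y + \sum_(b <- s) nu (y - b)%R = 0)%E.
  rewrite -[RHS](valuation1 nu) -[in RHS]yE Defs.valM val_prod.
  by congr (_ + _)%E; apply: eq_bigr => b _; rewrite hornerXsubC.
(* If nu y < 0, then integrality of each b forces nu (y - b) = nu y, and the sum in [nuE] would be
   negative. *)
have y_int : (0 <= nu y)%E.
  rewrite leNgt; apply/negP => y_lt0.
  have h : (nu y + \sum_(b <- s) nu (y - b)%R < 0)%E; last first.
    by rewrite nuE ltxx in h.
  apply: le_lt_trans (y_lt0); rewrite -[leRHS]adde0 leeD2l //.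
  rewrite big_seq; apply: sume_le0 => b bs;
    rewrite val_subC valB_ltr ?(ltW y_lt0) //.
  exact: lt_le_trans y_lt0 (s_int b bs).
have yb_int b : b \in s -> (0 <= nu (y - b)%R)%E.
  move=> bs; apply: le_trans (Defs.valD _ _ _).
  by rewrite le_min y_int valuationN s_int.
have S_ge0 : (0 <= \sum_(b <- s) nu (y - b)%R)%E.
  by rewrite big_seq; apply: sume_ge0.
have y0 : nu y = 0%E.
  by apply/le_anti; rewrite y_int andbT -nuE leeDl.
exists y => //; apply/allP => b bs; move: nuE; rewrite y0 add0e => S0.
rewrite eq_le yb_int // andbT -S0 (big_rem b) //= leeDl // big_seq.
by apply: sume_ge0 => c /mem_rem /yb_int.
Qed.

(** Dividing by x reduces to generic units. Only the b with nu b >= nu x enter [s'], where b / x is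
    integral; any other b dominates y - b as soon as nu y = nu x. *)
Lemma exists_generic (x : K) (s : seq K) : x != 0 ->
  exists2 y, nu y = nu x & all (fun b => nu (y - b)%R == mine (nu x) (nu b)) s.
Proof.
move=> x0; pose s' := [seq b / x | b <- s & (nu x <= nu b)%E].
have valZ (b : K) : nu b = (nu x + nu (b / x)%R)%E.
  by rewrite -Defs.valM mulrC divfK.
have [|u u0 /allP us] := @exists_generic_unit s'.
  apply/allP => _ /mapP[b + ->]; rewrite mem_filter => /andP[xb _].
  by move: xb; rewrite (valZ b) -leeBlDl ?(val_fin_num nu) // subee
    ?(val_fin_num nu).
exists (u * x); first by rewrite Defs.valM u0 add0e.
apply/allP => b bs; have [xb|bx] := leP (nu x) (nu b).
  have /us : b / x \in s' by apply/mapP; exists b; rewrite // mem_filter xb.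
  have -> : u * x - b = (u - b / x) * x by rewrite mulrBl divfK.
  by rewrite Defs.valM => /eqP ->; rewrite add0e.
by rewrite valB_ltr // Defs.valM u0 add0e.
Qed.

End AlgebraicallyClosedValuation.

(** * Marked curves in standard form *)

Section MarkedCurve.
Local Open Scope quotient_scope.
Variables (K : closedFieldType) (I : finType) (r d : nat).
Variables (C : marked_curve K I r d) (i0 : I).
Hypothesis C_std : standard_form C i0.

Local Notation L0 := (label I r d).
Local Notation Ltop := (Ltop r d i0).
Local Notation a := (a_coord C).
Local Notation c i := (hcoord (ev C i0) 0 i).

Definition aff_point (x : K) : 'rV[K]_2 := delta_mx 0 ord0 + x *: delta_mx 0
  ord_max.

Lemma aff_point0 x : aff_point x 0 ord0 = 1.
Proof. by rewrite !mxE /= mulr0 addr0. Qed.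

Lemma aff_point1 x : aff_point x 0 ord_max = x.
Proof. by rewrite !mxE /= mulr1 add0r. Qed.

Lemma aff_point_neq0 x : aff_point x != 0.
Proof.
by apply/eqP => /rowP /(_ ord0) /eqP; rewrite aff_point0 mxE oner_eq0.
Qed.

Lemma infty_neq0 : delta_mx 0 ord_max != 0 :> 'rV[K]_2.
Proof. by apply/eqP => /rowP /(_ ord_max) /eqP; rewrite !mxE /= oner_eq0. Qed.

Lemma in_Ltop (l : L0) : (l \in Ltop) = (l != inl i0).
Proof. by rewrite !inE. Qed.

Lemma inr_Ltop m : inr m \in Ltop.
Proof. by rewrite in_Ltop. Qed.

Lemma mark_aff (l : L0) : l \in Ltop -> mark C l = proj (aff_point (a l)).
Proof.
rewrite in_Ltop => li0; apply/affine_coordP => //.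
by rewrite -C_std (inj_eq (@mark_inj _ _ _ _ C)).
Qed.

Lemma a_coord_inj : {in Ltop &, injective a}.
Proof.
move=> l m lL mL alm; apply: (@mark_inj _ _ _ _ C).
by rewrite !mark_aff // alm.
Qed.

(** The fibre of f over {x_i = 0} consists of marks labelled by J, and p_{i_0} is not one of
    them. *)
Lemma ev_coord_neq0 i : c i != 0.
Proof.
apply/eqP => ci0.
have: (param C @^-1` hyperplane i) (mark C (inl i0)) by [].
by rewrite param_hyperplane => -[j _ /mark_inj].
Qed.

Lemma param_root i j : hcoord (param C (mark C (inr (i, j)))) 0 i = 0.
Proof.
suff: (param C @^-1` hyperplane i) (mark C (inr (i, j))) by [].
by rewrite param_hyperplane; exists j.
Qed.

Definition param_vec (x : K) : 'rV[K]_r.+1 :=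
  \row_i (c i * \prod_(j < d) (x - a (inr (i, j)))).

(** Evaluation at (0 : 1) shows that the i-th form has x^d-coefficient k c_i, with k nonzero and
    independent of i. So the i-th polynomial has exact degree d, and the d distinct a_ij at which it
    vanishes are all its roots. *)
Lemma param_aff x :
  param_vec x != 0 /\ param C (proj (aff_point x)) = proj (param_vec x).
Proof.
have [F FP] := param_morphism C.
pose p i : {poly K} := \poly_(k < d.+1) F i (inord k).
have pE y i : mor_eval F (aff_point y) 0 i = (p i).[y].
  rewrite mxE horner_poly; apply: eq_bigr => k _.
  by rewrite aff_point0 aff_point1 expr1n mulr1 inord_val.
(* At (0 : 1) the factor 0^(d-k) kills all monomials but k = d, where 0^0 = 1. *)
have topE i : mor_eval F (delta_mx 0 ord_max) 0 i = F i ord_max.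
  rewrite mxE (bigD1 ord_max) //= big1 ?addr0 => [|k kd].
    by rewrite !mxE /= subnn expr0 expr1n !mulr1.
  rewrite !mxE /= expr0n subn_eq0 leqNgt.
  rewrite ltn_neqAle -ltnS ltn_ord andbT.
  by move: kd; rewrite -val_eqE /= => ->; rewrite mulr0 mul0r.
have [k k0 kE] : exists2 k, k != 0 & forall i, F i ord_max = k * c i.
  have [h1 h2] := FP _ infty_neq0.
  have [k k0 kE] := hcoord_proj h1; exists k^-1; rewrite ?invr_eq0 // => i.
  by rewrite /ev C_std h2 kE mxE topE mulKf.
have pX i : p i = (k * c i) *: \prod_(z <- [seq a (inr (i, j)) | j <- enum
  'I_d]) ('X - z%:P).
  have lead0 : F i (inord d) = k * c i.
    by rewrite -kE; congr (F i _); apply: val_inj; rewrite /= inordK.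
  have sp : size (p i) = d.+1.
    by rewrite size_poly_eq // lead0 mulf_neq0 ?ev_coord_neq0.
  rewrite {1}[p i](@all_roots_prod_XsubC _ _ [seq a (inr (i, j)) | j <- enum
    'I_d]).
  - by rewrite lead_coefE sp coef_poly /= ltnSn lead0.
  - by rewrite sp size_map size_enum_ord.
  - apply/allP => _ /mapP[j _ ->]; rewrite rootE -pE.
    have [n0 hE] := FP _ (aff_point_neq0 (a (inr (i, j)))).
    apply/eqP/(hyperplaneP i n0); rewrite -hE -mark_aff ?inr_Ltop //.
    exact: param_root.
  - rewrite uniq_rootsE map_inj_uniq ?enum_uniq // => j j' /a_coord_inj.
    by case/(_ (inr_Ltop _) (inr_Ltop _)).
have mE : mor_eval F (aff_point x) = k *: param_vec x.
  apply/rowP => i; rewrite pE pX hornerZ !mxE mulrA; congr (_ * _).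
  rewrite horner_prod big_map big_enum /=; apply: eq_bigr => j _.
  by rewrite hornerXsubC.
have [n0 ->] := FP _ (aff_point_neq0 x).
have v0 : param_vec x != 0 by apply: contra_neq n0 => v0; rewrite mE v0 scaler0.
split=> //; apply/esym/proj_eqP => //.
by exists k.
Qed.

Lemma torus_aff x : torus K r (param C (proj (aff_point x))) <->
  forall m, x - a (inr m) != 0.
Proof.
have [v0 ->] := param_aff x; rewrite torusP //; split=> [h [i j]|h i].
  have := h i; rewrite mxE mulf_eq0 negb_or => /andP[_ /prodf_neq0].
  exact.
rewrite mxE mulf_neq0 ?ev_coord_neq0 //; apply/prodf_neq0 => j _.
exact: h.
Qed.

Variables (R : realType) (nu : valuation K R).

Lemma trop_aff x : (forall m, x - a (inr m) != 0) ->
  trop nu (param C (proj (aff_point x))) =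
  \pi_(TT R r) (\row_i (fine (nu (c i)) +
     \sum_(j < d) fine (nu (x - a (inr (i, j)))))).
Proof.
move=> xa; have [v0 E] := param_aff x.
have v_neq0 : forall i, param_vec x 0 i != 0.
  by apply/torusP => //; rewrite -E; apply/torus_aff.
rewrite E trop_proj //; congr (\pi_(TT R r) _); apply/rowP => i; rewrite !mxE.
rewrite fine_valM ?ev_coord_neq0 ?fine_val_prod //.
by apply/prodf_neq0.
Qed.

End MarkedCurve.

(** * The tree of clusters *)

Section Clusters.
Variables (K : closedFieldType) (R : realType) (nu : valuation K R).
Variables (I : finType) (r d : nat) (C : marked_curve K I r d) (i0 : I).
Hypothesis C_std : standard_form C i0.
Hypothesis L0_ge3 : (3 <= #|label I r d|)%N.

Local Notation L0 := (label I r d).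
Local Notation Ltop := (Ltop r d i0).
Local Notation a := (a_coord C).
Local Notation nu_set := (nu_set nu C).
Local Notation is_cluster := (is_cluster nu C i0).
Local Notation covers := (covers nu C i0).
Local Notation tedge := (tedge nu C i0).
Local Notation is_foot := (is_foot nu C i0).
Local Notation is_tvertex := (is_tvertex nu C i0).
Implicit Types (A B u v w : {set L0}) (l m : L0).

Lemma le_nu_setP t A :
  reflect {in A &, forall l m, (t <= nu (a m - a l)%R)%E} (t <= nu_set A)%E.
Proof.
rewrite /Defs.nu_set; apply: (iffP idP) => [/bigmin_geP[_ h] l m lA mA|h].
  by have /bigmin_geP[_ /(_ m mA)] := h l lA.
apply/bigmin_geP; split=> [|l lA]; first exact: leey.
by apply/bigmin_geP; split=> [|m mA]; [exact: leey | exact: h].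
Qed.

Lemma nu_set_le A l m : l \in A -> m \in A -> (nu_set A <= nu (a m - a l)%R)%E.
Proof. exact: (le_nu_setP _ _ (lexx _)). Qed.

Lemma nu_setS A B : A \subset B -> (nu_set B <= nu_set A)%E.
Proof.
by move=> /fintype.subsetP AB; apply/le_nu_setP => l m /AB ? /AB ?;
  apply: nu_set_le.
Qed.

(** The clusters turn out to be exactly the balls centred in L; radius +oo is allowed so that
    singletons are included. *)
Definition ball l (t : \bar R) : {set L0} :=
  [set m in Ltop | (t <= nu (a m - a l)%R)%E].

Lemma mem_ball l t m : (m \in ball l t) = (m \in Ltop) && (t <= nu (a m - a
  l)%R)%E.
Proof. by rewrite inE. Qed.

Lemma ball_center l t : l \in Ltop -> l \in ball l t.
Proof. by move=> lL; rewrite mem_ball lL subrr valuation0 leey. Qed.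

Lemma ball_subL l t : ball l t \subset Ltop.
Proof. by apply/fintype.subsetP => m; rewrite mem_ball => /andP[]. Qed.

Lemma nu_set_ball l t : (t <= nu_set (ball l t))%E.
Proof.
apply/le_nu_setP => m m'; rewrite !mem_ball => /andP[_ h] /andP[_ h'].
by apply: val_le_trans h' _; rewrite val_subC.
Qed.

(** A set B containing the ball with the same [nu_set], which is at least t, has all its members
    within radius t of l. *)
Lemma ball_cluster l t : l \in Ltop -> is_cluster (ball l t).
Proof.
move=> lL; apply/and3P; split; first by apply/finset.set0Pn; exists l;
  exact: ball_center.
  exact: ball_subL.
apply/forallP => B; apply/implyP => /and3P[BL sub /eqP E].
rewrite finset.eqEsubset sub andbT; apply/fintype.subsetP => m mB.
rewrite mem_ball (fintype.subsetP BL) //=; apply: le_trans (nu_set_ball l t) _.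
by rewrite E; apply: nu_set_le => //; apply: (fintype.subsetP sub);
  exact: ball_center.
Qed.

Lemma cluster_neq0 v : is_cluster v -> v != finset.set0.
Proof. by case/and3P. Qed.

Lemma cluster_subL v : is_cluster v -> v \subset Ltop.
Proof. by case/and3P. Qed.

(** The ball contains v and has the same [nu_set], so the maximality of v applies. *)
Lemma cluster_ball v l : is_cluster v -> l \in v -> v = ball l (nu_set v).
Proof.
case/and3P=> _ vL /forallP /(_ (ball l (nu_set v))) /implyP h lv.
apply/esym/eqP/h; rewrite ball_subL /tle.
have sub : v \subset ball l (nu_set v).
  apply/fintype.subsetP => m mv; rewrite mem_ball (fintype.subsetP vL) //=.
  exact: nu_set_le.
by rewrite sub eq_le nu_set_ball nu_setS.
Qed.

(** Both are balls around the common point l, nested according to their radii. *)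
Lemma cluster_leS v w l : is_cluster v -> is_cluster w -> l \in v -> l \in w ->
  (nu_set w <= nu_set v)%E -> v \subset w.
Proof.
move=> cv cw lv lw le_wv; rewrite (cluster_ball cv lv) (cluster_ball cw lw).
apply/fintype.subsetP => m; rewrite !mem_ball => /andP[-> h] /=.
exact: le_trans le_wv h.
Qed.

Lemma cluster_ltP v w l : is_cluster v -> is_cluster w -> l \in v -> l \in w ->
  (v \proper w) = (nu_set w < nu_set v)%E.
Proof.
move=> cv cw lv lw; apply/idP/idP => [vw|h].
  rewrite ltNge; apply: contraL vw => h; rewrite fintype.properE negb_and negbK.
  by rewrite (cluster_leS cw cv lw lv h) orbT.
rewrite fintype.properE (cluster_leS cv cw lv lw (ltW h)) /=.
by apply: contraL h => /nu_setS; rewrite leNgt.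
Qed.

Lemma cardLtop : (1 < #|Ltop|)%N.
Proof. by rewrite cardsC1 -ltnS prednK // (leq_trans _ L0_ge3). Qed.

Lemma exists_in_Ltop : exists l, l \in Ltop.
Proof. by apply/finset.set0Pn; rewrite -card_gt0 (leq_trans _ cardLtop). Qed.

Lemma cluster_Ltop : is_cluster Ltop.
Proof.
apply/and3P; split=> //; first by rewrite -card_gt0 (leq_trans _ cardLtop).
by apply/forallP => B; apply/implyP => /and3P[BL LB _];
  rewrite finset.eqEsubset BL.
Qed.

Lemma cluster_set1 l : l \in Ltop -> is_cluster [set l].
Proof.
move=> lL; suff -> : [set l]%SET = ball l +oo by apply: ball_cluster.
apply/finset.setP => m; rewrite mem_ball inE; apply/eqP/andP => [->|[mL]].
  by rewrite subrr valuation0.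
rewrite leye_eq => /eqP/val_eqy/eqP; rewrite subr_eq0 => /eqP.
exact: (a_coord_inj C_std).
Qed.

Lemma nu_set1 l : nu_set [set l] = +oo%E.
Proof.
apply/eqP; rewrite -leye_eq;
  apply/le_nu_setP => m m' /finset.set1P-> /finset.set1P->.
by rewrite subrr valuation0.
Qed.

(** By the ultrametric inequality, the minimum over all pairs is attained at a pair containing a
    fixed l. Hence heights of inner vertices lie in the value group. *)
Lemma nu_set_attained v : v \subset Ltop -> (1 < #|v|)%N ->
  exists2 x, x != 0 & nu_set v = nu x.
Proof.
move=> /fintype.subsetP vL /card_gt1P[l [l' [lv l'v ll']]].
have neq m : m \in v -> m != l -> a m - a l != 0.
  move=> mv; apply: contra_neq => /eqP; rewrite subr_eq0 => /eqP.
  by apply: (a_coord_inj C_std); apply: vL.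
have Pl' : (l' \in v) && (l' != l) by rewrite l'v eq_sym.
have [m /andP[mv ml] mmin] := 
  @arg_minP _ _ _ l' (fun m => (m \in v) && (m != l)) (fun m => nu (a m - a l))
    Pl'.
exists (a m - a l); first exact: neq.
apply/le_anti; rewrite nu_set_le //=; apply/le_nu_setP => n n' nv n'v.
have h k : k \in v -> (nu (a m - a l)%R <= nu (a k - a l)%R)%E.
  move=> kv; have [->|kl] := eqVneq k l; first by rewrite subrr valuation0 leey.
  by apply: mmin; rewrite /= kv.
by apply: (val_le_trans (y := a l)); rewrite ?h // val_subC h.
Qed.

Lemma nu_set_fin v : v \subset Ltop -> (1 < #|v|)%N -> nu_set v \is a fin_num.
Proof. by move=> vL v1; have [x x0 ->] := nu_set_attained vL v1;
  exact: val_fin_num. Qed.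

(** Otherwise the ball around l of radius nu (a_m - a_l) would be a cluster strictly between v and
    w. *)
Lemma covers_notin w v l m : covers w v -> l \in v -> m \in Ltop -> m \notin v
  ->
  (nu (a m - a l)%R <= nu_set w)%E.
Proof.
case/and4P=> cw cv vw /existsPn max_v lv mL mv; rewrite leNgt; apply/negP => h.
have lL := fintype.subsetP (cluster_subL cv) _ lv.
have cB := ball_cluster (nu (a m - a l)) lL.
have lB := ball_center (nu (a m - a l)) lL.
have lw := fintype.subsetP (fintype.proper_sub vw) _ lv.
have mB : m \in ball l (nu (a m - a l)) by rewrite mem_ball mL lexx.
have Bw : (nu_set w < nu_set (ball l (nu (a m - a l)%R)))%E.
  exact: lt_le_trans h (nu_set_ball _ _).
have vB : (nu_set (ball l (nu (a m - a l)%R)) < nu_set v)%E.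
  rewrite ltNge; apply: contra mv => h'.
  exact: (fintype.subsetP (cluster_leS cB cv lB lv h')).
have /negP[] := max_v (ball l (nu (a m - a l))).
by rewrite cB (cluster_ltP cv cB lv lB) (cluster_ltP cB cw lB lw) vB Bw.
Qed.

Lemma exists_parent v : is_cluster v -> v != Ltop -> exists w, covers w v.
Proof.
move=> cv vL; pose P w := is_cluster w && (v \proper w).
have [|w /minsetP[/andP[cw vw] wmin]] := @ex_minset _ P.
  by exists Ltop; rewrite /P cluster_Ltop finset.properEneq vL cluster_subL.
exists w; apply/and4P; split=> //; apply/existsPn => u; apply/negP.
case/and3P=> cu vu uw; have := wmin u; rewrite /P cu vu (fintype.proper_sub uw).
by move=> /(_ erefl erefl) uE; rewrite uE fintype.properxx in uw.
Qed.

Lemma exists_child v : is_cluster v -> (1 < #|v|)%N -> exists u, covers v u.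
Proof.
move=> cv v1; have /finset.set0Pn[l lv] := cluster_neq0 cv.
pose P u := is_cluster u && (u \proper v).
have [|u /maxsetP[/andP[cu uv] umax]] := @ex_maxset _ P.
  exists [set l]%SET; rewrite /P cluster_set1 ?(fintype.subsetP (cluster_subL
    cv)) //=.
  by rewrite finset.properEcard finset.sub1set lv cards1.
exists u; apply/and4P; split=> //; apply/existsPn => w; apply/negP.
case/and3P=> cw uw wv; have := umax w; rewrite /P cw wv (fintype.proper_sub uw).
by move=> /(_ erefl erefl) wE; rewrite wE fintype.properxx in uw.
Qed.

(** Two covers of v share a point, so they are comparable; if they differed, one would lie strictly
    between v and the other. *)
Lemma covers_unique w w' v : covers w v -> covers w' v -> w = w'.
Proof.
have aux u u' : covers u v -> covers u' v -> u \subset u'.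
  case/and4P=> cu cv vu /existsPn max_v /and4P[cu' _ vu' _].
  have /finset.set0Pn[l lv] := cluster_neq0 cv.
  have lu := fintype.subsetP (fintype.proper_sub vu) _ lv.
  have lu' := fintype.subsetP (fintype.proper_sub vu') _ lv.
  have [/(cluster_leS cu cu' lu lu') //|h] := leP (nu_set u') (nu_set u).
  have /negP[] := max_v u'.
  by rewrite cu' vu' (cluster_ltP cu' cu lu' lu).
by move=> h h'; apply/eqP; rewrite finset.eqEsubset !aux.
Qed.

Lemma foot_i0_cluster : is_cluster (foot (inl i0)) = false.
Proof.
by apply/negP => /cluster_subL; rewrite finset.sub1set in_Ltop eqxx.
Qed.

Lemma cluster_neq_foot_i0 v : is_cluster v -> v != foot (inl i0).
Proof. by move=> cv; apply: contraTneq cv => ->; rewrite foot_i0_cluster. Qed.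

Lemma tedge_foot_i0 w : tedge w (foot (inl i0)) = (w == Ltop).
Proof. by rewrite /Defs.tedge /Defs.covers foot_i0_cluster andbF eqxx andbT.
  Qed.

Lemma tedge_cluster w v : is_cluster v -> tedge w v = covers w v.
Proof.
move=> cv; rewrite /Defs.tedge (negPf (cluster_neq_foot_i0 cv)) andbF.
exact: orbF.
Qed.

Lemma tedge_from_cluster w v : tedge w v -> is_cluster w.
Proof. by case/orP=> [/and4P[]|/andP[/eqP-> _]] //; exact: cluster_Ltop. Qed.

(** A singleton cluster is adjacent only to its parent, and {i_0} only to L. A larger cluster has a
    child and, in addition, a parent or, in the case of L, the foot {i_0}. *)
Lemma is_footE v : is_tvertex v -> is_foot v = (#|v| == 1)%N.
Proof.
move=> tv; rewrite /Defs.is_foot tv /=; case/orP: tv => [cv|/eqP->]; last first.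
  rewrite cards1 eqxx; apply/eqP.
  rewrite -[RHS](cards1 Ltop); congr #|pred_of_set _|; apply/finset.setP => u.
  rewrite !inE tedge_foot_i0 [tedge _ _](_ : _ = false) ?orbF //.
  by apply/negP => /tedge_from_cluster; rewrite foot_i0_cluster.
have [/cards1P[l vE]|v1] := boolP (#|v| == 1)%N.
  have lv : l \in v by rewrite vE finset.set11.
  have vL : v != Ltop.
    by apply: contraTneq cardLtop => <-; rewrite vE cards1.
  have [w wv] := exists_parent cv vL.
  apply/eqP; rewrite -[RHS](cards1 w).
  congr #|pred_of_set _|; apply/finset.setP => u; rewrite !inE tedge_cluster //.
  apply/orP/eqP => [[uv|]|->]; [exact: covers_unique uv wv| |by left].
  case/orP=> [/and4P[_ /cluster_neq0/finset.set0Pn[m mu] + _]|]; last first.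
    by rewrite (negPf vL).
  move=> /proper_card; rewrite vE cards1 ltnS leqn0 cards_eq0 => /eqP u0.
  by rewrite u0 inE in mu.
have {v1} v1 : (1 < #|v|)%N.
  by rewrite ltn_neqAle eq_sym v1 card_gt0 cluster_neq0.
apply/negbTE; rewrite neq_ltn; apply/orP; right; apply/card_gt1P.
have [u vu] := exists_child cv v1; have /and4P[_ cu uv _] := vu.
have uN : tedge v u by rewrite tedge_cluster.
have [vL|vL] := eqVneq v Ltop.
  exists u, (foot (inl i0));
    rewrite !inE uN orbT [in X in _ || X]vL tedge_foot_i0.
  by rewrite eqxx orbT; split=> //; exact: cluster_neq_foot_i0.
have [w wv] := exists_parent cv vL.
exists u, w; rewrite !inE uN orbT (tedge_cluster _ cv) wv; split=> //.
have /and4P[_ _ vw _] := wv.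
by apply: contraTneq (fintype.proper_trans uv vw) => ->;
  rewrite fintype.properxx.
Qed.

Lemma exists_path v : is_cluster v ->
  exists p, path tedge Ltop p /\ last Ltop p = v.
Proof.
have [n] := ubnP #|~: v|; elim: n v => // n IH v lt_v cv.
have [->|vL] := eqVneq v Ltop; first by exists [::].
have [w wv] := exists_parent cv vL; have /and4P[cw _ vw _] := wv.
have [|p [pP pL]] := IH w _ cw.
  rewrite -ltnS; apply: leq_trans lt_v; rewrite ltnS.
  by apply: proper_card; rewrite finset.properC.
exists (rcons p v); rewrite rcons_path pP pL last_rcons; split=> //=.
by rewrite tedge_cluster.
Qed.

End Clusters.

(** * The tropical torus *)

Section TropicalTorusTheory.
Local Open Scope quotient_scope.
Variables (R : realType) (r : nat).
Local Notation tpi := (\pi_(TT R r)).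

Lemma sum_svec (u : 'rV[R]_r.+1) : \sum_i u 0 i *: svec i = tpi u.
Proof.
rewrite [in RHS](row_sum_delta u) linear_sum; apply: eq_bigr => i _.
by rewrite linearZ.
Qed.

Lemma tpi_eqP (u v : 'rV[R]_r.+1) :
  tpi u = tpi v <-> exists k, forall i, u 0 i - v 0 i = k.
Proof.
split=> [/eqP|[k h]].
  rewrite -Quotient.idealrBE unfold_in => /sub_rVP[k uv]; exists k => i.
  by have /rowP/(_ i) := uv; rewrite !mxE mulr1.
apply/eqP; rewrite -Quotient.idealrBE unfold_in; apply/sub_rVP; exists k.
by apply/rowP => i; rewrite !mxE mulr1 -(h i).
Qed.

Lemma s_setE (I : finType) (d : nat) (A : {set label I r d}) :
  s_set R A = tpi (\row_i #|[set j : 'I_d | inr (i, j) \in A]%SET|%:R).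
Proof. by rewrite -sum_svec; apply: eq_bigr => i _; rewrite mxE. Qed.

Lemma s_set_foot_inl (I : finType) (d : nat) (i : I) :
  s_set R (foot (inl i) : {set label I r d}) = 0.
Proof.
rewrite /s_set big1 // => k _; rewrite [X in X%:R](_ : _ = 0%N) ?scale0r //.
by apply: eq_card0 => j; rewrite !inE.
Qed.

Variables (K : fieldType) (nu : valuation K R).

Lemma Gamma_pointsB (z z' : TT R r) :
  Gamma_points r nu z -> Gamma_points r nu z' -> Gamma_points r nu (z - z').
Proof.
move=> [u hu <-] [v hv <-]; exists (u - v); last by rewrite raddfB.
by move=> i; rewrite !mxE; apply: value_groupB.
Qed.

Lemma Gamma_points_trop (P : PP K r) : torus K r P -> Gamma_points r nu (trop
  nu P).
Proof.
move=> tP; eexists; last by [].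
by move=> i; rewrite mxE; apply/value_groupV/tP.
Qed.

End TropicalTorusTheory.

(** Let n_i be the coordinates of s_A. Modulo the diagonal, all t (n_i - n_0) lie in the value
    group. If all n_i agree, then s_A = 0; otherwise a nonzero integer multiple of t lies in this
    divisible group. *)
Lemma Gamma_points_s_set (K : closedFieldType) (R : realType)
    (nu : valuation K R) (I : finType) (r d : nat) (A : {set label I r d}) (t :
      R) :
  Gamma_points r nu (t *: s_set R A) -> s_set R A = 0 \/ value_group nu t.
Proof.
rewrite s_setE -linearZ => -[g hg] /esym/tpi_eqP[k hk].
set n := fun i : 'I_r.+1 => #|[set j : 'I_d | inr (i, j) \in A]%SET| in hk *.
have [/forallP n0|/forallPn[i ni]] := boolP [forall i, n i == n 0].
  left; rewrite -(raddf0 \pi_(TT R r)%qT); apply/tpi_eqP; exists (n 0)%:R => i.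
  by rewrite !mxE subr0 -/(n i) (eqP (n0 i)).
right; have h j : t * (n j)%:R - t * (n 0)%:R = g 0 j - g 0 0.
  have := hk j; have := hk 0; rewrite !mxE -/(n _) => <- /(canRL (subrK _)) ->.
  by ring.
have [lt_n|lt_n|E] := ltngtP (n i) (n 0); last by rewrite E eqxx in ni.
  apply: (@value_group_divisible _ _ nu (n 0 - n i)); first by rewrite subn_gt0.
  rewrite -mulr_natr natrB ?(ltnW lt_n) // mulrBr -opprB h.
  by apply/value_groupN/value_groupB.
apply: (@value_group_divisible _ _ nu (n i - n 0)); first by rewrite subn_gt0.
by rewrite -mulr_natr natrB ?(ltnW lt_n) // mulrBr h; apply: value_groupB.
Qed.

(** * Positions on the tropical curve *)

Section CorrespondingTropicalCurveTheory.
Local Open Scope quotient_scope.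
Variables (K : closedFieldType) (R : realType) (nu : valuation K R).
Variables (I : finType) (r d : nat) (C : marked_curve K I r d) (i0 : I).
Hypothesis C_std : standard_form C i0.
Hypothesis L0_ge3 : (3 <= #|label I r d|)%N.

Local Notation L0 := (label I r d).
Local Notation Ltop := (Ltop r d i0).
Local Notation a := (a_coord C).
Local Notation c i := (hcoord (ev C i0) 0 i).
Local Notation nu_set := (nu_set nu C).
Local Notation is_cluster := (is_cluster nu C i0).
Local Notation covers := (covers nu C i0).
Local Notation tedge := (tedge nu C i0).
Local Notation vertex_pos := (vertex_pos nu C i0).
Local Notation tmap := (tmap nu C i0).
Local Notation tcurve := (tcurve nu C i0).
Local Notation tpi := (\pi_(TT R r)).
Implicit Types (A B u v w : {set L0}) (l m : L0).

(** The minimum with a real t is finite even at x = 0, so [fine] loses nothing; x = 0 occurs in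
    [trop_pt] when l is in J. *)
Definition trunc_val (t : R) (x : K) : R := fine (mine t%:E (nu x)).

Lemma trunc_val_ge t x : (t%:E <= nu x)%E -> trunc_val t x = t.
Proof. by move=> h; rewrite /trunc_val min_l. Qed.

Lemma trunc_val_le t x : (nu x <= t%:E)%E -> trunc_val t x = fine (nu x).
Proof. by move=> h; rewrite /trunc_val min_r. Qed.

(* The tropicalization of f(1 : a_l + y) for a generic y of valuation t. *)
Definition trop_pt l (t : R) : TT R r :=
  tpi (\row_i (fine (nu (c i)) +
    \sum_(j < d) trunc_val t (a (inr (i, j)) - a l))).

(** Going from height s to t, the truncated value grows by t - s for each label in v and stays
    constant for the labels outside v. *)
Lemma trop_pt_edge l v s t : s <= t ->
  (forall m, m \in v -> t%:E <= nu (a m - a l)%R)%E ->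
  (forall m, m \in Ltop -> m \notin v -> nu (a m - a l)%R <= s%:E)%E ->
  trop_pt l t = trop_pt l s + (t - s) *: s_set R v.
Proof.
move=> st hv hNv; rewrite s_setE -linearZ -raddfD /=; congr tpi.
apply/rowP => i; rewrite !mxE -addrA; congr (_ + _).
rewrite -sum1_card natr_sum mulr_sumr [X in _ = _ + X]big_mkcond -big_split /=.
apply: eq_bigr => j _; rewrite inE; case: ifPn => ijv.
  rewrite !trunc_val_ge ?hv ?mulr1 ?[s + _]addrC ?subrK //.
  by apply: le_trans (hv _ ijv); rewrite lee_fin.
have h := hNv _ (inr_Ltop _ _) ijv.
by rewrite !trunc_val_le ?addr0 //; apply: le_trans h _; rewrite lee_fin.
Qed.

(** Every term is truncated to t, so all coordinates are shifted by d t and the class is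
    unchanged. *)
Lemma trop_pt_top l t : (forall m, m \in Ltop -> t%:E <= nu (a m - a l)%R)%E ->
  trop_pt l t = trop nu (ev C i0).
Proof.
move=> h; apply/tpi_eqP; exists (t *+ d) => i; rewrite !mxE addrC addKr.
rewrite -[in RHS](card_ord d) -sumr_const; apply: eq_bigr => j _.
by rewrite trunc_val_ge // h ?inr_Ltop.
Qed.

Lemma trop_pt_nu_Ltop l : l \in Ltop ->
  trop_pt l (fine (nu_set Ltop)) = trop nu (ev C i0).
Proof.
have fin : nu_set Ltop \is a fin_num by rewrite (nu_set_fin nu C_std) ?cardLtop.
by move=> lL; apply: trop_pt_top => m mL; rewrite fineK // nu_set_le.
Qed.

Lemma tlengthE w v : is_cluster v -> tlength nu C i0 w v = (nu_set v - nu_set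
  w)%E.
Proof. by move=> cv; rewrite /tlength (negPf (cluster_neq_foot_i0 cv)). Qed.

Lemma path_displacement_rcons w p v :
  path_displacement nu C i0 w (rcons p v) = path_displacement nu C i0 w p +
    fine (tlength nu C i0 (last w p) v) *: s_set R v.
Proof. by elim: p w => [|u p IH] w /=; rewrite ?addr0 ?add0r // IH addrA. Qed.

Lemma covers_card w v : covers w v -> (1 < #|w|)%N.
Proof.
case/and4P=> _ cv vw _; apply: leq_ltn_trans (proper_card vw).
by rewrite card_gt0 (cluster_neq0 cv).
Qed.

Lemma covers_fin w v : covers w v -> nu_set w \is a fin_num.
Proof.
move=> wv; have /and4P[cw _ _ _] := wv.
by rewrite (nu_set_fin nu C_std) ?(cluster_subL cw) ?(covers_card wv).
Qed.

Lemma covers_lt w v l : covers w v -> l \in v -> (nu_set w < nu_set v)%E.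
Proof.
case/and4P=> cw cv vw _ lv; rewrite -(cluster_ltP cv cw lv) //.
exact: (fintype.subsetP (fintype.proper_sub vw)).
Qed.

Lemma trop_pt_covers w v l t : covers w v -> l \in v ->
  fine (nu_set w) <= t -> (t%:E <= nu_set v)%E ->
  trop_pt l t = trop_pt l (fine (nu_set w)) + (t - fine (nu_set w)) *: s_set R
    v.
Proof.
move=> wv lv st tv; apply: trop_pt_edge => // m.
  by move=> mv; apply: le_trans tv _; apply: nu_set_le.
move=> mL mv; rewrite fineK ?(covers_fin wv) //.
exact: covers_notin wv lv mL mv.
Qed.

(** Induction from the end of the path: its last edge raises the height from [nu_set w] to
    [nu_set v] in direction s_v, and l, being in v, also lies in w. *)
Lemma path_displacementE p l : path tedge Ltop p ->
  is_cluster (last Ltop p) -> (1 < #|last Ltop p|)%N -> l \in last Ltop p ->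
  trop nu (ev C i0) + path_displacement nu C i0 Ltop p =
  trop_pt l (fine (nu_set (last Ltop p))).
Proof.
elim/last_ind: p l => [|p v IH] l.
  by move=> _ _ _ lL /=; rewrite addr0 trop_pt_nu_Ltop.
rewrite rcons_path last_rcons path_displacement_rcons => /andP[pP pv] cv v1 lv.
rewrite tedge_cluster // in pv; set w := last _ p in pv IH *.
have /and4P[cw _ vw _] := pv.
have lw := fintype.subsetP (fintype.proper_sub vw) _ lv.
have vfin : nu_set v \is a fin_num by rewrite (nu_set_fin nu C_std)
  ?(cluster_subL cv).
have wfin := covers_fin pv.
rewrite addrA (IH l) ?(covers_card pv) // tlengthE // fineB //.
rewrite [RHS](trop_pt_covers pv lv) // ?fineK //.
by rewrite -lee_fin !fineK // ltW // (covers_lt pv lv).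
Qed.

(** [path_from_top] is obtained by choice, but every path from L to v yields the same position. *)
Lemma vertex_posE v l : is_cluster v -> (1 < #|v|)%N -> l \in v ->
  vertex_pos v = trop_pt l (fine (nu_set v)).
Proof.
move=> cv v1 lv; rewrite /Defs.vertex_pos.
have -> : \sum_(i < r.+1) fine (nu (c i)) *: svec i = trop nu (ev C i0).
  by rewrite /trop -sum_svec; apply: eq_bigr => i _; rewrite mxE.
have [pP pv] : path tedge Ltop (path_from_top nu C i0 v) /\
    last Ltop (path_from_top nu C i0 v) = v.
  exact: xgetPex (exists_path L0_ge3 cv).
by rewrite -{2}pv; apply: path_displacementE; rewrite ?pv.
Qed.

Lemma vertex_pos_Ltop : vertex_pos Ltop = trop nu (ev C i0).
Proof.
have [l lL] := exists_in_Ltop i0 L0_ge3.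
rewrite (vertex_posE (cluster_Ltop nu C i0 L0_ge3) _ lL) ?cardLtop //.
exact: trop_pt_nu_Ltop.
Qed.

Lemma is_innerP v : is_inner nu C i0 v <-> is_cluster v /\ (1 < #|v|)%N.
Proof.
split=> [/andP[tv]|[cv v1]].
  rewrite (is_footE C_std L0_ge3 tv) => v1.
  case/orP: tv => [cv|/eqP vi]; last by rewrite vi cards1 in v1.
  by rewrite ltn_neqAle eq_sym v1 card_gt0 (cluster_neq0 cv).
have tv : is_tvertex nu C i0 v by rewrite /is_tvertex cv.
by rewrite /is_inner tv (is_footE C_std L0_ge3 tv) neq_ltn v1 orbT.
Qed.

Lemma tmap_edge w v l t : tcurve (TEdge w v t) -> covers w v -> l \in v ->
  tmap (TEdge w v t) = trop_pt l (fine (nu_set w)) + t *: s_set R v /\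
  tmap (TEdge w v t) = trop_pt l (fine (nu_set w) + t).
Proof.
move=> [_ t0 tl] wv lv; have /and4P[cw cv vw _] := wv.
have lw := fintype.subsetP (fintype.proper_sub vw) _ lv.
have wfin := covers_fin wv; rewrite tlengthE // in tl.
have tv : ((fine (nu_set w) + t)%:E <= nu_set v)%E.
  by rewrite EFinD fineK // addeC -leeBrDr // ltW.
have E := trop_pt_covers wv lv (_ : _ <= fine (nu_set w) + t) tv.
rewrite lerDl ltW // in E; rewrite E // [_ + t]addrC addrK.
suff -> : tmap (TEdge w v t) = trop_pt l (fine (nu_set w)) + t *: s_set R v by
  [].
have tvv : is_tvertex nu C i0 v by rewrite /is_tvertex cv.
rewrite /= (is_footE C_std L0_ge3 tvv) (vertex_posE cw _ lw) ?(covers_card wv)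
  //.
case: ifPn => // v1; have {v1} v1 : (1 < #|v|)%N.
  by rewrite ltn_neqAle eq_sym v1 card_gt0 (cluster_neq0 cv).
have vfin : nu_set v \is a fin_num by rewrite (nu_set_fin nu C_std)
  ?(cluster_subL cv).
have lt_wv : fine (nu_set w) < fine (nu_set v).
  by rewrite -lte_fin !fineK // (covers_lt wv lv).
(* The end positions of a bounded edge differ by its length times s_v, so interpolation moves with
   direction s_v, as on a leg. *)
rewrite (vertex_posE cv v1 lv) (trop_pt_covers wv lv (ltW lt_wv)) ?fineK //.
rewrite [_ + (_ *: s_set _ _)]addrC addrK tlengthE // fineB // scalerA divfK //.
by rewrite subr_eq0 gt_eqF.
Qed.

Lemma tmap_leg_i0 w t : tcurve (TEdge w (foot (inl i0)) t) ->
  tmap (TEdge w (foot (inl i0)) t) = trop nu (ev C i0).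
Proof.
move=> [+ _ _]; rewrite tedge_foot_i0 => /eqP->.
have tv : is_tvertex nu C i0 (foot (inl i0)) by rewrite /is_tvertex eqxx orbT.
rewrite /= (is_footE C_std L0_ge3 tv) cards1 eqxx s_set_foot_inl scaler0 addr0.
exact: vertex_pos_Ltop.
Qed.

Lemma Ltop_tcurve : tcurve (TVertex R Ltop).
Proof. by apply/is_innerP; rewrite cluster_Ltop ?cardLtop. Qed.

(** Let B be the ball of radius t around l. If B = L, the point is the position of L; if [nu_set B]
    equals t, it is that of the vertex B; otherwise t lies strictly between the heights of B and its
    parent, on the edge joining them. *)
Lemma trop_pt_image l t : l \in Ltop -> (tmap @` tcurve) (trop_pt l t).
Proof.
move=> lL; pose B := ball nu C i0 l t%:E.
have cB : is_cluster B by apply: ball_cluster.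
have lB : l \in B by apply: ball_center.
have tB : (t%:E <= nu_set B)%E by apply: nu_set_ball.
have [BL|BL] := eqVneq B Ltop.
  exists (TVertex R Ltop); first exact: Ltop_tcurve.
  rewrite /= vertex_pos_Ltop trop_pt_top // => m.
  by rewrite -BL mem_ball => /andP[].
have [w wB] := exists_parent L0_ge3 cB BL; have /and4P[cw _ Bw _] := wB.
have lw := fintype.subsetP (fintype.proper_sub Bw) _ lB.
have wfin := covers_fin wB.
have wt : (nu_set w < t%:E)%E.
  have [_ [m mw]] := fintype.properP Bw; rewrite mem_ball.
  rewrite (fintype.subsetP (cluster_subL cw) _ mw) /= -ltNge.
  by apply: le_lt_trans; apply: nu_set_le.
have [tE|tB'] := eqVneq (nu_set B) t%:E.
  have B1 : (1 < #|B|)%N.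
    rewrite ltn_neqAle eq_sym card_gt0 (cluster_neq0 cB) andbT.
    by apply: contra_eqN tE => /cards1P[m ->]; rewrite nu_set1.
  exists (TVertex R B); first exact/is_innerP.
  by rewrite /= (vertex_posE cB B1 lB) tE.
have ht : tcurve (TEdge w B (t - fine (nu_set w))).
  split; first by rewrite tedge_cluster.
    by rewrite subr_gt0 -lte_fin fineK.
  rewrite tlengthE // EFinB fineK // lteBrDr // subeK //.
  by rewrite lt_neqAle eq_sym tB' tB.
exists (TEdge w B (t - fine (nu_set w))) => //.
by have [_ ->] := tmap_edge ht wB lB; rewrite addrC subrK.
Qed.

(** * Tropicalizations of points of f(P^1) as points P(l, t) *)

Lemma trop_pt_realized l t : value_group nu t ->
  (trop nu @` (range (param C) `&` torus K r)) (trop_pt l t).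
Proof.
move=> /value_groupP[y0 y00 y0t].
have [y yE /allP y_gen] := exists_generic nu [seq a (inr p) - a l | p <- enum
  {: 'I_r.+1 * 'I_d}] y00.
have dE p : a l + y - a (inr p) = y - (a (inr p) - a l) by ring.
have gen p : nu (a l + y - a (inr p)) = mine t%:E (nu (a (inr p) - a l)).
  by rewrite dE -y0t; apply/eqP/y_gen/map_f; rewrite mem_enum.
(* A zero difference would have valuation +oo, but the right side of [gen] is at most t. *)
have neq p : a l + y - a (inr p) != 0.
  apply: contraPneq (gen p) => ->; rewrite valuation0.
  have [_ //|h E] := leP t%:E (nu (a (inr p) - a l)).
  by rewrite -E ltNge leey in h.
exists (param C (proj (aff_point (a l + y)))).
  by split; [exists (proj (aff_point (a l + y))) | apply/(torus_aff C_std)].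
rewrite (trop_aff C_std) //; congr tpi; apply/rowP => i; rewrite !mxE.
by congr (_ + _); apply: eq_bigr => j _; rewrite gen.
Qed.

Lemma trop_aff_trop_pt x : (forall p, x - a (inr p) != 0) ->
  exists2 l, l \in Ltop & exists t, trop nu (param C (proj (aff_point x))) =
    trop_pt l t.
Proof.
move=> xa; have [l0 l0L] := exists_in_Ltop i0 L0_ge3.
have [l lL lmax] :=
  @arg_maxP _ _ _ l0 (fun l => l \in Ltop) (fun l => nu (x - a l)) l0L.
exists l => //; suff [t h] : exists t, forall p,
    fine (nu (x - a (inr p))) = trunc_val t (a (inr p) - a l).
  exists t; rewrite (trop_aff C_std) //; congr tpi; apply/rowP => i;
    rewrite !mxE.
  by congr (_ + _); apply: eq_bigr => j _; rewrite h.
have [/eqP|xl] := eqVneq (x - a l) 0.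
  rewrite subr_eq0 => /eqP xl; have cl := cluster_set1 nu C_std lL.
  have lNL : [set l]%SET != Ltop.
    by apply: contraTneq (cardLtop i0 L0_ge3) => <-; rewrite cards1.
  have [w wl] := exists_parent L0_ge3 cl lNL.
  (* If x = a_l, no real t equals nu (x - a_l). The height of the parent of {l} works instead: it is
     at least nu (a_m - a_l) for all other m, so truncation changes nothing. *)
  exists (fine (nu_set w)) => p; rewrite xl val_subC trunc_val_le //.
  rewrite fineK ?(covers_fin wl) //.
  apply: covers_notin wl (finset.set11 l) (inr_Ltop _ _) _; rewrite inE.
  by apply: contra_neq (xa p) => ->; rewrite xl subrr.
exists (fine (nu (x - a l))) => p; rewrite /trunc_val fineK_val //; congr fine.
have -> : x - a (inr p) = (x - a l) - (a (inr p) - a l) by ring.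
(* In the first case cancellation in x - a_p is excluded by the maximality of l. *)
have [h|h] := leP (nu (x - a l)) (nu (a (inr p) - a l)); last exact: valB_ltr.
apply/le_anti/andP; split; last first.
  by apply: le_trans (Defs.valD _ _ _); rewrite le_min valuationN lexx h.
have -> : (x - a l) - (a (inr p) - a l) = x - a (inr p) by ring.
by apply: lmax; apply: inr_Ltop.
Qed.

End CorrespondingTropicalCurveTheory.

Theorem proposition3p4 (R : realType) (K : closedFieldType)
    (charK0 : [pchar K] =i pred0) (nu : valuation K R)
    (I : finType) (r d : nat) (r_ge1 : (1 <= r)%N)
    (L0_ge3 : (3 <= #|label I r d|)%N) (i0 : I)
    (C : marked_curve K I r d) (C_std : standard_form C i0) :
  tmap nu C i0 @` tcurve nu C i0 `&` Gamma_points r nu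
    = trop nu @` (range (param C) `&` torus K r)
  /\ forall i : I,
       tmap nu C i0 @` leg nu C i0 (inl i) = [set trop nu (ev C i)].
Proof.
have ev_i0_torus : torus K r (ev C i0) by move=> i; apply: ev_coord_neq0.
split.
  apply/seteqP; split=> [_ [[x xC <-] Gx]|_ [P [[Q _ <-] PT] <-]]; last first.
    split; last exact: Gamma_points_trop.
    (* The point (0 : 1), outside the chart (1 : x), is p_{i_0}; it corresponds to the vertex L. *)
    have [QE|Qi0] := eqVneq Q (proj (delta_mx 0 ord_max)).
      exists (TVertex R (Ltop r d i0)); first exact: Ltop_tcurve.
      by rewrite /= vertex_pos_Ltop // /ev QE C_std.
    have QE : Q = proj (aff_point (affine_coord Q)) by apply/(affine_coordP _
      Qi0).
    move: PT; rewrite QE => /(torus_aff C_std)/(trop_aff_trop_pt nu C_std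
      L0_ge3).
    by move=> [l lL [t ->]]; apply: trop_pt_image.
  case: x xC Gx => [v /(is_innerP nu C_std L0_ge3)[cv v1] _|w v t xC Gx].
    have /finset.set0Pn[l lv] := cluster_neq0 cv.
    rewrite /= (vertex_posE C_std L0_ge3 cv v1 lv).
    have [x x0 ->] := nu_set_attained nu C_std (cluster_subL cv) v1.
    by apply: (trop_pt_realized C_std); apply: value_groupV.
  (* The leg to {i_0} is contracted to the tropicalization of f(p_{i_0}), which lies in the
     torus. *)
  have [wv _ _] := xC; case/orP: (wv) => [{}wv|/andP[_ /eqP vE]]; last first.
    rewrite vE in xC *; rewrite (tmap_leg_i0 C_std L0_ge3 xC).
    by exists (ev C i0) => //; split=> //; exists (mark C (inl i0)).
  have /and4P[cw cv vw _] := wv.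
  have /finset.set0Pn[l lv] := cluster_neq0 cv.
  have [x x0 wx] := nu_set_attained nu C_std (cluster_subL cw) (covers_card wv).
  have [E1 E2] := tmap_edge C_std L0_ge3 xC wv lv.
  have G1 : value_group nu (fine (nu_set nu C w)) by rewrite wx;
    apply: value_groupV.
  have lL := fintype.subsetP (cluster_subL cv) _ lv.
  have R1 := trop_pt_realized C_std l G1.
  (* This is the difference of the given point and the position of w, both with coordinates in the
     value group. *)
  have : Gamma_points r nu (t *: s_set R v).
    rewrite -[_ *: _](addKr (trop_pt nu C i0 l (fine (nu_set nu C w)))) -E1
      addrC.
    apply: Gamma_pointsB => //.
    by case: R1 => P [_ PT] <-; apply: Gamma_points_trop.
  move=> /Gamma_points_s_set[s0|Gt]; first by rewrite E1 s0 scaler0 addr0.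
  by rewrite E2; apply: trop_pt_realized => //; apply: value_groupD.
move=> i; have [->|ii0] := eqVneq i i0.
  apply/seteqP; split=> [_ [x [xC xl] <-]|_ ->]; last first.
    exists (TVertex R (Ltop r d i0)); last exact: vertex_pos_Ltop.
    by split; [exact: Ltop_tcurve | rewrite tedge_foot_i0].
  case: x xC xl => [v _|w v t xC vE]; last first.
    by move: xC; rewrite vE => /(tmap_leg_i0 C_std L0_ge3).
  by rewrite /= tedge_foot_i0 => /eqP->; apply: vertex_pos_Ltop.
have iL : inl i \in Ltop r d i0 by rewrite in_Ltop;
  apply: contra_neq ii0 => -[->].
have ci := cluster_set1 nu C_std iL.
have iF : inl i \in (foot (inl i) : {set label I r d}) by apply: finset.set11.
have a_neq p : a_coord C (inl i) - a_coord C (inr p) != 0.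
  apply/eqP => /eqP; rewrite subr_eq0 => /eqP.
  by move=> /(a_coord_inj C_std iL (inr_Ltop _ _)).
(* At the height of w, the parent of {i}, no truncation takes effect any more, so w already sits at
   the tropicalization of f(1 : a_i). *)
have posE w : covers nu C i0 w (foot (inl i)) -> vertex_pos nu C i0 w = trop nu
  (ev C i).
  move=> wi; have /and4P[cw _ iw _] := wi.
  have {}iw := fintype.subsetP (fintype.proper_sub iw) _ iF.
  rewrite (vertex_posE C_std L0_ge3 cw (covers_card wi) iw).
  rewrite /ev (mark_aff C_std iL) (trop_aff C_std) //; congr (\pi_(TT R r))%qT.
  apply/rowP => k; rewrite !mxE; congr (_ + _); apply: eq_bigr => j _.
  rewrite trunc_val_le 1?val_subC // fineK ?(covers_fin C_std wi) //.
  by rewrite val_subC; apply: covers_notin wi iF (inr_Ltop _ _) _; rewrite inE.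
have tmapE w t : tcurve nu C i0 (TEdge w (foot (inl i)) t) ->
    covers nu C i0 w (foot (inl i)) ->
    tmap nu C i0 (TEdge w (foot (inl i)) t) = vertex_pos nu C i0 w.
  move=> xC wi; have [-> _] := tmap_edge C_std L0_ge3 xC wi iF.
  have /and4P[cw _ iw _] := wi.
  have {}iw := fintype.subsetP (fintype.proper_sub iw) _ iF.
  rewrite s_set_foot_inl scaler0 addr0.
  by rewrite (vertex_posE C_std L0_ge3 cw (covers_card wi) iw).
apply/seteqP; split=> [_ [x [xC xl] <-]|_ ->].
  case: x xC xl => [w _|w v t xC vE].
    by rewrite /= tedge_cluster // => /posE.
  move: xC; rewrite vE => xC; have [wi _ _] := xC.
  by rewrite tedge_cluster // in wi; rewrite tmapE // posE.
have iNL : foot (inl i) != Ltop r d i0.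
  by apply: contraTneq (cardLtop i0 L0_ge3) => <-; rewrite cards1.
(* The inner end of the leg serves as a preimage of the point. *)
have [w wi] := exists_parent L0_ge3 ci iNL; exists (TVertex R w);
  last exact: posE.
split; last by rewrite tedge_cluster.
have /and4P[cw _ _ _] := wi.
by apply/is_innerP => //; split=> //; apply: covers_card wi.
Qed.
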